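(* Let $\Delta\ge 3$ be an integer. (i) There is a sequence of instances $(\mathcal{T}_n,w_n)$, with $\mathcal{T}_n$ a finite tree of maximum degree at most $\Delta$ and $w_n:V(\mathcal{T}_n)\to\mathbb{R}_{\ge0}$, such that for every choice of centroid trees $C_n$ of $(\mathcal{T}_n,w_n)$, $$\lim_{n\to\infty}\frac{\mathtt{cost}_{w_n}(C_n)}{\mathtt{OPT}(\mathcal{T}_n,w_n)}=2-\frac{1}{2^\Delta}.$$ (ii) There is a sequence of instances $(\mathcal{T}_n,w_n)$ with $\mathcal{T}_n$ of maximum degree at most $\Delta$, $w_n(\mathcal{T}_n)=1$, and $\lim_{n\to\infty}\mathtt{OPT}(\mathcal{T}_n,w_n)=\infty$, such that every centroid tree $C_n$ of $(\mathcal{T}_n,w_n)$ satisfies $$\mathtt{cost}_{w_n}(C_n)\ge\left(2-\frac{4}{2^\Delta}\right)\mathtt{OPT}(\mathcal{T}_n,w_n)-1.$$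
   Context: For a subgraph $\mathcal{H}$ of $\mathcal{T}$, $w(\mathcal{H})=\sum_{x\in V(\mathcal{H})}w(x)$. A search tree on a tree $\mathcal{T}$ is a rooted tree $T$ with vertex set $V(\mathcal{T})$ defined recursively: its root is an arbitrary vertex $r$, and the children of $r$ are the roots of search trees built on the connected components of $\mathcal{T}-r$; a single-vertex tree has only itself as search tree. $\mathtt{cost}_w(T)=\sum_x w(x)\,\mathtt{depth}_T(x)$ with root depth $1$; $\mathtt{OPT}(\mathcal{T},w)$ is the minimum cost over all search trees on $\mathcal{T}$. A vertex $v$ is a centroid of $(\mathcal{T},w)$ if each component $\mathcal{H}$ of $\mathcal{T}-v$ has $w(\mathcal{H})\le w(\mathcal{T})/2$. A search tree $T$ is a centroid tree if each vertex $x$ is a centroid of $(\mathcal{T}[V(T_x)],w)$, $T_x$ being the subtree of $T$ rooted at $x$. *)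

(* Defs.v *)
From HB Require Import structures.
From mathcomp Require Import all_boot all_order all_algebra.
From mathcomp Require Import all_classical all_reals all_analysis.
Set Implicit Arguments. Unset Strict Implicit. Unset Printing Implicit Defensive.
Import Order.TTheory GRing.Theory Num.Theory.
Local Open Scope ring_scope.

Inductive rtree (V : Type) : Type := RNode : V -> seq (rtree V) -> rtree V.
Arguments RNode {V}.

Section Trees.
Variables (V : finType) (e : rel V).

(* A finite tree: symmetric irreflexive adjacency, nonempty, connected,
   with |E| = |V| - 1 (counted as ordered pairs: 2(|V|-1)). *)
Definition is_tree : Prop :=
  [/\ symmetric e, irreflexive e, (0 < #|V|)%N,
      (forall x y, connect e x y) &
      #|[set p : V * V | e p.1 p.2]| = (2 * (#|V| - 1))%N].

Definition max_deg_le (D : nat) : Prop :=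
  forall x : V, (#|[set y | e x y]| <= D)%N.

Definition restr (S : {set V}) : rel V := [rel a b | [&& a \in S, b \in S & e a b]].
Definition comp (S : {set V}) (x : V) : {set V} :=
  [set y in S | connect (restr S) x y].
Definition components (S : {set V}) : {set {set V}} := [set comp S x | x in S].

Fixpoint vset (t : rtree V) : {set V} :=
  let: RNode r ch := t in
  r |: (fix vs (l : seq (rtree V)) : {set V} :=
          if l is c :: l' then vset c :|: vs l' else finset.set0) ch.

(* t is a search tree on the vertex set S (S inducing a subtree of the tree):
   its root r lies in S and its children are (bijectively) search trees
   on the connected components of S - r. *)
Fixpoint is_stree (S : {set V}) (t : rtree V) : Prop :=
  let: RNode r ch := t in
  [/\ r \in S, uniq (map vset ch),
      [set X | X \in map vset ch] = components (S :\ r) &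
      (fix all_st (l : seq (rtree V)) : Prop :=
         if l is c :: l' then is_stree (vset c) c /\ all_st l' else True) ch].

Definition search_tree (t : rtree V) : Prop := is_stree [set: V] t.

Variables (R : realType) (w : V -> R).

Definition wsum (S : {set V}) : R := \sum_(x in S) w x.

Fixpoint costd (d : nat) (t : rtree V) : R :=
  let: RNode r ch := t in
  w r * d%:R + (fix cs (l : seq (rtree V)) : R :=
                  if l is c :: l' then costd d.+1 c + cs l' else 0) ch.

Definition cost (t : rtree V) : R := costd 1 t.

Definition OPT : R := inf (fun c : R => exists t, search_tree t /\ c = cost t).

Definition is_centroid (H : {set V}) (v : V) : Prop :=
  v \in H /\ forall K, K \in components (H :\ v) -> wsum K <= wsum H / 2.

Fixpoint centroid_nodes (t : rtree V) : Prop :=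
  let: RNode r ch := t in
  is_centroid (vset t) r /\
  (fix all_c (l : seq (rtree V)) : Prop :=
     if l is c :: l' then centroid_nodes c /\ all_c l' else True) ch.

Definition centroid_tree (t : rtree V) : Prop := search_tree t /\ centroid_nodes t.

End Trees.

(* Main.v *)
Require Import Defs.
From HB Require Import structures.
From mathcomp Require Import all_boot all_order all_algebra.
From mathcomp Require Import all_classical all_reals all_analysis.
From mathcomp Require Import zify ring lra.
Import Order.TTheory GRing.Theory Num.Theory.
Import numFieldNormedType.Exports.
Local Open Scope ring_scope.

Set Implicit Arguments.
Unset Strict Implicit.
Unset Printing Implicit Defensive.

(* Two weighted trees [X], [Y] of weight 1 are joined through a new vertex [c] of small
   weight [d], the weights of [X] and [Y] being scaled by [q = (1 - d) / 2].  Then [c] is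
   the only centroid, so centroid trees cost exactly [1 + q (c_X + c_Y)].  On the other
   hand, if [X] has a cheap search tree rooted at the joining vertex, one can remove that
   vertex first, hang a search tree of [Y] below it, and put [c] at the bottom, paying
   about [1 / 2] less.

   Join [k] copies of the current instance in this way to one hub vertex [x], with weights
   [q], [q^2], ..., [q^k].  Centroid trees remove the [k] connecting vertices one at a time
   and pay [1 + q + ... + q^(k-1)], about [2 - 2 / 2^k], to separate the copies, while
   removing [x] first costs only 1.  In (i) the hub is a single vertex and
   [k = Delta]; iterating gives [OPT] close to [2^Delta] and centroid trees of cost
   [2 - 1 / 2^Delta] times as much.  In (ii) the hub is a leaf of a further copy and
   [k = Delta - 1], so that no weight is lost and [OPT] grows linearly with the number of
   iterations.

   Upper and lower bounds on [OPT] go through vertex rankings: depths in a search tree are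
   labels such that two vertices with equal label are separated by a smaller one, and
   conversely any such labelling bounds the depths of some search tree.  Since only one
   vertex of a connected graph carries the least label, all labels on one side of a joined
   instance can be lowered by one, which gives
   [OPT >= q (OPT_X + OPT_Y) + 1 - q]. *)

(** * Search trees and components *)

Section RtreeInduction.
Variables (V : Type) (P : rtree V -> Prop).
Hypothesis H : forall r ch, (forall c, List.In c ch -> P c) -> P (RNode r ch).

(** Children sit in a list nested inside the constructor, so the automatic induction principle says
    nothing about them. Membership is [List.In] because [rtree V] is given no decidable equality. *)
Fixpoint rtree_In_ind (t : rtree V) : P t :=
  let: RNode r ch := t in
  @H r ch ((fix all_P (l : seq (rtree V)) : forall c, List.In c l -> P c :=
    if l is a :: l' then
      fun c Hc => match Hc with
                  | or_introl e => eq_ind a P (rtree_In_ind a) c e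
                  | or_intror Hc' => all_P l' c Hc'
                  end
    else fun c Hc => False_ind (P c) Hc) ch).

End RtreeInduction.

Section Unfolding.
Context {V : finType}.
Implicit Types (e : rel V) (S K : {set V}) (t c : rtree V) (ch : seq (rtree V)).

Lemma vsetE r ch x :
  x \in vset (RNode r ch) <-> x = r \/ exists2 c, List.In c ch & x \in vset c.
Proof.
rewrite /= in_setU1; have E : forall l, x \in ((fix vs (l : seq (rtree V)) : {set V} :=
   if l is c :: l' then vset c :|: vs l' else finset.set0) l) <->
   exists2 c, List.In c l & x \in vset c.
  elim=> [|c l IH]; first by rewrite inE; split => // -[].
  rewrite inE; split.
    case/orP=> [xc|/IH [c' cl xc']]; first by exists c => //; left.
    by exists c' => //; right.
  case=> c' [<- ->//|cl xc']; apply/orP; right; apply/IH; by exists c'.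
split; first by case/orP=> [/eqP->|/E]; [left|right].
by case=> [->|/E ->]; rewrite ?eqxx ?orbT.
Qed.

Lemma is_streeE e S r ch :
  is_stree e S (RNode r ch) <->
  [/\ r \in S, uniq (map (@vset V) ch),
      [set X | X \in map (@vset V) ch] = components e (S :\ r) &
      forall c, List.In c ch -> is_stree e (vset c) c].
Proof.
rewrite /=; set F := (X in [/\ _, _, _ & X ch]).
have E l : F l <-> forall c, List.In c l -> is_stree e (vset c) c.
  elim: l => [|c l IH] //=; split.
    by case=> Hc /IH Hl c' [<-|/Hl].
  by move=> Hl; split; [apply: Hl; left|apply/IH => c' c'l; apply: Hl; right].
by split=> -[? ? ? /E].
Qed.

Lemma In_mem_vset ch c : List.In c ch -> vset c \in map (@vset V) ch.
Proof.
elim: ch => //= a l IH [->|/IH]; first by rewrite mem_head.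
by rewrite inE => ->; rewrite orbT.
Qed.

Lemma mem_vset_In ch K : K \in map (@vset V) ch -> exists2 c, List.In c ch & vset c = K.
Proof.
elim: ch => //= a l IH; rewrite inE => /orP[/eqP->|/IH [c cl <-]].
  by exists a => //; left.
by exists c => //; right.
Qed.

Context {R : realType} (w : V -> R).

Lemma centroid_nodesE e r ch :
  centroid_nodes e w (RNode r ch) <->
  is_centroid e w (vset (RNode r ch)) r /\
  forall c, List.In c ch -> centroid_nodes e w c.
Proof.
rewrite /=; set F := (X in _ /\ X ch <-> _).
have E l : F l <-> forall c, List.In c l -> centroid_nodes e w c.
  elim: l => [|c l IH] //=; split.
    by case=> Hc /IH Hl c' [<-|/Hl].
  by move=> Hl; split; [apply: Hl; left|apply/IH => c' c'l; apply: Hl; right].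
by split=> -[? /E].
Qed.

(** The vertex sets of the children are distinct and are exactly the components left by the root, so
    a child cost that depends only on the vertex set can be summed over components instead of over
    the list. *)
Lemma stree_node_cost e S r ch d (G : {set V} -> R) :
    is_stree e S (RNode r ch) ->
    (forall c, List.In c ch -> costd w d.+1 c = G (vset c)) ->
  costd w d (RNode r ch) = w r * d%:R + \sum_(K in components e (S :\ r)) G K.
Proof.
case/is_streeE=> _ U <- _ HG; rewrite /=; congr (_ + _).
rewrite (eq_bigl (mem (map (@vset V) ch))); last by move=> K; rewrite inE.
rewrite -big_uniq //= big_map.
elim: ch HG {U} => [|c l IH] HG; first by rewrite big_nil.
rewrite big_cons HG; last by left.
by rewrite IH // => c' c'l; apply: HG; right.
Qed.

End Unfolding.

Section Components.
Context {V : finType} (e : rel V).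
Hypothesis esym : symmetric e.
Implicit Types (S K : {set V}).

Lemma restr_sym S : symmetric (restr e S).
Proof. by move=> x y; rewrite /restr /= esym andbCA. Qed.

Lemma connect_restr_sym S : connect_sym (restr e S).
Proof. exact/sym_connect_sym/restr_sym. Qed.

Lemma comp_refl S x : x \in S -> x \in Defs.comp e S x.
Proof. by move=> xS; rewrite inE xS connect0. Qed.

Lemma comp_sub S x : Defs.comp e S x \subset S.
Proof. by apply/fintype.subsetP => y; rewrite inE => /andP[]. Qed.

Lemma comp_eq S x y : y \in Defs.comp e S x -> Defs.comp e S y = Defs.comp e S x.
Proof.
rewrite inE => /andP[yS xy]; apply/finset.setP=> z; rewrite !inE.
by rewrite (same_connect (connect_restr_sym S) xy).
Qed.

Lemma mem_components S K x : K \in components e S -> x \in K -> Defs.comp e S x = K.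
Proof. by case/imsetP => y yS -> /comp_eq. Qed.

Lemma componentsP S K x : K \in components e S -> x \in K ->
  x \in S /\ Defs.comp e S x = K.
Proof.
move=> Kc xK; split; last exact: mem_components.
by case/imsetP: Kc xK => y yS -> /(fintype.subsetP (comp_sub _ _)).
Qed.

Lemma comp_in_components S x : x \in S -> Defs.comp e S x \in components e S.
Proof. by move=> xS; apply: imset_f. Qed.

Lemma sum_components (R : zmodType) S (F : V -> R) :
  \sum_(x in S) F x = \sum_(K in components e S) \sum_(x in K) F x.
Proof.
rewrite (partition_big (Defs.comp e S) (mem (components e S))) /=; last first.
  by move=> x xS; apply: comp_in_components.
apply: eq_bigr => K Kc; apply: eq_bigl => x.
apply/andP/idP => [[xS /eqP <-]|xK]; first exact: comp_refl.
by have [-> ->] := componentsP Kc xK.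
Qed.

Lemma closed_set_connect S (A : {set V}) x y :
    (forall u v, u \in A -> v \in S -> e u v -> v \in A) ->
  x \in A -> connect (restr e S) x y -> y \in A.
Proof.
move=> clA xA; have cl : fingraph.closed (restr e S) (mem A).
  move=> u v /and3P[uS vS uv]; apply/idP/idP => [uA|vA]; first exact: clA uv.
  by apply: clA vA uS _; rewrite esym.
by move/(closed_connect cl) => <-.
Qed.

Lemma comp_closed_set S (A : {set V}) x :
    A \subset S -> x \in A ->
    (forall y, y \in A -> connect (restr e S) x y) ->
    (forall u v, u \in A -> v \in S -> e u v -> v \in A) ->
  Defs.comp e S x = A.
Proof.
move=> /fintype.subsetP AS xA cA clA; apply/finset.setP => y; rewrite inE.
apply/andP/idP=> [[_]|yA]; first exact: closed_set_connect.
by split; [exact: AS|exact: cA].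
Qed.

End Components.

Lemma connect_img {V W : finType} (e : rel V) (e' : rel W) (f : V -> W) x y :
    (forall a b, e a b -> connect e' (f a) (f b)) ->
  connect e x y -> connect e' (f x) (f y).
Proof.
move=> He /connectP [p]; elim: p x => [x _ ->|z p IH x /= /andP[xz zp] yl].
  exact: connect0.
exact: connect_trans (He _ _ xz) (IH _ zp yl).
Qed.

(** * Rankings *)

(* Vertices with equal labels are separated by a smaller label. *)
Definition ranking_on {V : finType} (e : rel V) (S : {set V}) (h : V -> nat) :=
  forall x y, x \in S -> y \in S -> h x = h y ->
  connect (restr e (S :&: [set z | (h x <= h z)%N])) x y -> x = y.

Lemma vset_inj {V : finType} (ch : seq (rtree V)) c c' :
    uniq (map (@vset V) ch) -> List.In c ch -> List.In c' ch ->
  vset c = vset c' -> c = c'.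
Proof.
elim: ch => //= a l IH /andP[al ul] [<-|cl] [<-|c'l] // E.
- by move: al; rewrite E (In_mem_vset c'l).
- by move: al; rewrite -E (In_mem_vset cl).
- exact: IH.
Qed.

Section SearchTreesAndRankings.
Context {V : finType} (e : rel V).
Hypothesis esym : symmetric e.
Implicit Types (S K : {set V}) (t : rtree V) (h : V -> nat).

Lemma vset_stree S t : is_stree e S t -> vset t = S.
Proof.
elim/rtree_In_ind: t S => r ch IH S /is_streeE[rS _ chS Hch].
apply/finset.setP => x; apply/idP/idP => [/vsetE[->//|[c /In_mem_vset cch xc]]|xS].
  have : vset c \in components e (S :\ r) by rewrite -chS inE.
  by case/(componentsP esym)/(_ xc) => /setD1P[].
apply/vsetE; have [->|xr] := eqVneq x r; [by left|right].
have xS' : x \in S :\ r by apply/setD1P.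
have := comp_in_components e xS'; rewrite -chS inE => /mem_vset_In[c cch Ec].
by exists c => //; rewrite Ec comp_refl.
Qed.

(** The labels are depths, the root having label 0. A path between equal positive labels that meets
    no smaller label avoids the root, hence stays in one component, where induction applies. One
    labelling serves all weights and all root depths [d]. *)
Lemma stree_ranking S t : is_stree e S t ->
  exists2 h, ranking_on e S h & forall (R : realType) (w : V -> R) d,
    costd w d t = \sum_(x in S) w x * (h x + d)%:R.
Proof.
elim/rtree_In_ind: t S => r ch IH S St.
have /is_streeE[rS U chS Hch] := St.
(* A labelling is chosen for every set at once: distinct children have distinct vertex sets, so [K]
   determines the child, and sets that come from no child get the constant label 0. *)
have /choice[f Hf] (K : {set V}) : exists h, forall c, List.In c ch -> vset c = K ->
    ranking_on e K h /\ forall (R : realType) (w : V -> R) d,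
    costd w d c = \sum_(x in K) w x * (h x + d)%:R.
  have [[c [cch Ec]]|nc] := pselect (exists c, List.In c ch /\ vset c = K).
    have [h Hh Ch] := IH c cch _ (Hch c cch).
    exists h => c' c'ch Ec'; have <- : c = c' by apply: (vset_inj U); rewrite ?Ec.
    by rewrite -Ec.
  by exists (fun=> 0%N) => c cch Ec; case: nc; exists c.
pose h z := if z == r then 0%N else (f (Defs.comp e (S :\ r) z) z).+1.
have hr : h r = 0%N by rewrite /h eqxx.
have hK K z : K \in components e (S :\ r) -> z \in K -> h z = (f K z).+1.
  move=> Kc zK; have [/setD1P[zr _] Ez] := componentsP esym Kc zK.
  by rewrite /h (negPf zr) Ez.
exists h => [x y xS yS hxy xy|R w d].
  have [xr|xr] := eqVneq x r.
    by move: hxy; rewrite xr hr /h; case: eqVneq.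
  have yr : y != r by apply: contra_neq xr => yr; move: hxy; rewrite yr hr /h; case: eqVneq.
  have xS' : x \in S :\ r by apply/setD1P.
  have [K Kc xK] : exists2 K, K \in components e (S :\ r) & x \in K.
    by exists (Defs.comp e (S :\ r) x); [apply: comp_in_components|apply: comp_refl].
  have := Kc; rewrite -chS inE => /mem_vset_In[c cch Ec].
  have [rk _] := Hf K c cch Ec.
  (* The vertices reached from [x] inside [K] through labels at least [f K x]. The path in [S]
     cannot leave this set, so its endpoint is reached inside [K] as well. *)
  pose A := [set v in K | (f K x <= f K v)%N &&
    connect (restr e (K :&: [set z | (f K x <= f K z)%N])) x v].
  have : y \in A.
    apply: closed_set_connect xy => //; last by rewrite inE xK leqnn connect0.
    move=> u v; rewrite !inE => /and3P[uK fu xu] /andP[vS hxv] uv.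
    have vr : v != r by apply: contraTneq hxv => ->; rewrite hr (hK K).
    have [uS' Eu] := componentsP esym Kc uK.
    have vK : v \in K.
      rewrite -Eu inE; apply/andP; split; first by apply/setD1P.
      by apply: connect1; rewrite /restr /= uS' uv andbT; apply/setD1P.
    have fv : (f K x <= f K v)%N by move: hxv; rewrite !(hK K).
    rewrite vK fv /=; apply: connect_trans xu _.
    by apply: connect1; rewrite /restr /= !inE uK vK fu fv uv.
  rewrite inE => /and3P[yK _ xy'].
  by apply: rk xy' => //; move: hxy; rewrite !(hK K) // => -[].
rewrite (stree_node_cost (w := w) (G := fun K => \sum_(x in K) w x * (h x + d)%:R) St).
  rewrite (big_setD1 r) //= hr add0n; congr (_ + _).
  by rewrite (sum_components esym).
move=> c cch; have Kc := In_mem_vset cch.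
have [_ ->] := Hf _ c cch erefl; apply: eq_bigr => x xc.
by rewrite (hK (vset c)) ?addSnnS // -chS inE.
Qed.

End SearchTreesAndRankings.

Definition connected_in {V : finType} (e : rel V) (S : {set V}) :=
  forall x y, x \in S -> y \in S -> connect (restr e S) x y.

Lemma connect_restr_sub {V : finType} (e : rel V) (S S' : {set V}) x y :
  S \subset S' -> connect (restr e S) x y -> connect (restr e S') x y.
Proof.
move=> /fintype.subsetP sS; apply: (connect_img (f := id)) => a b /and3P[aS bS ab].
by apply: connect1; rewrite /restr /= !sS.
Qed.

Lemma ranking_on_sub {V : finType} (e : rel V) (S S' : {set V}) h :
  S' \subset S -> ranking_on e S h -> ranking_on e S' h.
Proof.
move=> sS rk x y xS yS hxy xy; apply: rk => //; try exact: fintype.subsetP sS _ _.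
by apply: connect_restr_sub xy; apply: finset.setSI.
Qed.

Section RankingsToSearchTrees.
Context {V : finType} (e : rel V).
Hypothesis esym : symmetric e.
Implicit Types (S K : {set V}) (t : rtree V) (h : V -> nat).

Lemma component_connected S K : K \in components e S -> connected_in e K.
Proof.
move=> Kc x y xK yK; have [xS Ex] := componentsP esym Kc xK.
pose A := [set v in K | connect (restr e K) x v].
have : y \in A.
  have : connect (restr e S) x y by move: yK; rewrite -Ex inE => /andP[].
  apply: closed_set_connect => //; last by rewrite inE xK connect0.
  move=> u v; rewrite !inE => /andP[uK xu] vS uv.
  have [uS Eu] := componentsP esym Kc uK.
  have vK : v \in K by rewrite -Eu inE vS; apply: connect1; rewrite /restr /= uS vS.
  by rewrite vK; apply: connect_trans xu _; apply: connect1; rewrite /restr /= uK vK.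
by rewrite inE => /andP[].
Qed.

(** The root is a vertex of least label, unique since [S] is connected. Every other label is then
    positive, so labels drop by one on each remaining component, which pays for the extra level of
    depth in the induction. *)
Lemma ranking_stree (R : realType) (w : V -> R) S h :
    (forall x, 0 <= w x) -> S != finset.set0 -> connected_in e S ->
    ranking_on e S h ->
  exists2 t, is_stree e S t &
    forall d, costd w d t <= \sum_(x in S) w x * (h x + d)%:R.
Proof.
move=> w0; have [n] := ubnP #|S|; elim: n S h => // n IH S h /ltnSE Sn /set0Pn[x0 x0S] cS rk.
have [r rS rmin] := @arg_minnP _ x0 [pred x in S] h x0S; rewrite inE in rS.
have hr x : x \in S :\ r -> (h r < h x)%N.
  case/setD1P=> xr xS; rewrite ltn_neqAle rmin // andbT.
  apply: contra_neq xr => hxr; symmetry; apply: rk => //.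
  rewrite (_ : _ :&: _ = S); first exact: cS.
  by apply/finset.setIidPl/fintype.subsetP => y yS; rewrite inE; apply: rmin.
have /choice[f Hf] (K : {set V}) : exists t, K \in components e (S :\ r) ->
    is_stree e K t /\ forall d, costd w d t <= \sum_(x in K) w x * ((h x).-1 + d)%:R.
  have [Kc|] := boolP (K \in components e (S :\ r)); last by exists (RNode r [::]).
  have KS : K \subset S :\ r by case/imsetP: Kc => z _ ->; apply: comp_sub.
  have [||||t Kt Ct] := IH K (fun x => (h x).-1).
  - apply: leq_trans Sn; apply: leq_ltn_trans (subset_leq_card KS) _.
    by rewrite [X in (_ < X)%N](cardsD1 r) rS.
  - case/imsetP: Kc => z zS ->; apply/set0Pn; exists z; exact: comp_refl.
  - exact: component_connected Kc.
  - move=> x y xK yK hxy xy.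
    have xS := fintype.subsetP KS _ xK; have yS := fintype.subsetP KS _ yK.
    have hE : h x = h y by have := hr _ xS; have := hr _ yS; lia.
    apply: (ranking_on_sub _ rk xK yK hE).
      exact: fintype.subset_trans KS (finset.subD1set _ _).
    apply: connect_restr_sub xy; apply/fintype.subsetP => z; rewrite !inE => /andP[zK].
    have := hr _ (fintype.subsetP KS _ zK); rewrite zK /=; lia.
  by exists t.
pose ch := map f (enum (components e (S :\ r))).
have vch : map (@vset V) ch = enum (components e (S :\ r)).
  rewrite -map_comp -[RHS]map_id; apply/eq_in_map => K; rewrite mem_enum => /Hf[Kt _].
  exact: vset_stree Kt.
have Inch c : List.In c ch -> exists2 K, K \in components e (S :\ r) & c = f K.
  rewrite /ch; have : {subset enum (components e (S :\ r)) <= components e (S :\ r)}.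
    by move=> K; rewrite mem_enum.
  elim: (enum _) => //= K l IHl sub [<-|cl].
    by exists K => //; apply: sub; rewrite mem_head.
  by apply: IHl => // K' K'l; apply: sub; rewrite inE K'l orbT.
have St : is_stree e S (RNode r ch).
  apply/is_streeE; split => //; rewrite ?vch ?enum_uniq //.
    by apply/finset.setP => K; rewrite inE mem_enum.
  by move=> c /Inch[K /Hf[Kt _] ->]; rewrite (vset_stree _ Kt).
exists (RNode r ch) => // d.
rewrite (stree_node_cost (w := w) (G := fun K => costd w d.+1 (f K)) St).
  rewrite (big_setD1 r) //= (sum_components esym); apply: lerD.
    by rewrite ler_wpM2l // ler_nat leq_addl.
  apply: ler_sum => K Kc; have [_ /(_ d.+1)] := Hf _ Kc.
  move/le_trans; apply; apply: ler_sum => x xK.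
  have [xS _] := componentsP esym Kc xK.
  by rewrite ler_wpM2l // ler_nat; have := hr _ xS; lia.
move=> c /Inch[K Kc ->]; have [Kt _] := Hf _ Kc; by rewrite (vset_stree _ Kt).
Qed.

End RankingsToSearchTrees.

Definition ranking {V : finType} (e : rel V) (h : V -> nat) :=
  forall x y, h x = h y -> connect (restr e [set z | (h x <= h z)%N]) x y -> x = y.

Lemma ranking_setT {V : finType} (e : rel V) h :
  ranking_on e [set: V] h <-> ranking e h.
Proof.
split=> rk x y; last by move=> _ _; have := rk x y; rewrite finset.setTI.
by have := rk x y; rewrite finset.setTI !finset.in_setT; apply.
Qed.

(** * Bounding the optimum by rankings *)

Section OPTBounds.
Context {V : finType} (e : rel V) {R : realType} (w : V -> R).
Hypotheses (esym : symmetric e) (e_conn : forall x y, connect e x y).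
Hypotheses (V0 : (0 < #|V|)%N) (w0 : forall x, 0 <= w x).

Lemma connected_setT : connected_in e [set: V].
Proof.
move=> x y _ _; apply: (connect_img (f := id)) (e_conn x y) => a b ab.
by apply: connect1; rewrite /restr /= !inE.
Qed.

Lemma setT_neq0 : [set: V] != finset.set0.
Proof. by rewrite -card_gt0 cardsT. Qed.

Lemma OPT_le_ranking h : ranking e h -> OPT e w <= \sum_x w x * (h x).+1%:R.
Proof.
move/ranking_setT => rk.
have [t St /(_ 1%N) Ct] := ranking_stree esym w0 setT_neq0 connected_setT rk.
apply: (@le_trans _ _ (cost w t)); last first.
  apply: le_trans Ct _; rewrite le_eqVlt; apply/orP; left; apply/eqP.
  by apply: eq_big => x; rewrite ?inE // addn1.
apply: ge_inf; last by exists t.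
exists 0 => _ [t' [/(stree_ranking esym)[h' _ C'] ->]].
by rewrite /cost C'; apply: sumr_ge0 => x _; rewrite mulr_ge0.
Qed.

Lemma OPT_ge_ranking b :
  (forall h, ranking e h -> b <= \sum_x w x * (h x).+1%:R) -> b <= OPT e w.
Proof.
move=> Hb; apply: lb_le_inf.
  (* An injective labelling is a ranking, so some search tree exists and the infimum is taken over a
     nonempty set. *)
  have rk : ranking_on e [set: V] (fun x => enum_rank x).
    by move=> x y _ _ /ord_inj/enum_rank_inj.
  have [t St _] := ranking_stree esym w0 setT_neq0 connected_setT rk.
  by exists (cost w t), t.
move=> _ [t [/(stree_ranking esym)[h /ranking_setT rk C] ->]].
rewrite /cost C; apply: le_trans (Hb _ rk) _; rewrite le_eqVlt; apply/orP; left; apply/eqP.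
by apply: eq_big => x; rewrite ?inE // addn1.
Qed.

End OPTBounds.

(** * Joining two instances by a bridge vertex *)

Record inst (R : realType) := Inst { iV : finType; ie : rel iV; iw : iV -> R }.
Arguments ie {R} i : rename.
Arguments iw {R} i : rename.

Lemma big_option {R : Type} {idx : R} {op : Monoid.com_law idx} {T : finType}
    (F : option T -> R) :
  \big[op/idx]_u F u = op (F None) (\big[op/idx]_x F (Some x)).
Proof.
rewrite (bigD1 None) //=; congr (op _ _).
rewrite [LHS]big_mkcond [LHS](bigD1 None) //= Monoid.mul1m.
rewrite [LHS](reindex_omap (op := op) Some id) /=; last by case.
by apply: eq_big => x; rewrite ?eqxx.
Qed.

(** Labels equal under [h'] are equal under [h], and the upper level sets of [h'] lie in those of
    [h]. This serves to shift labels. *)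
Lemma ranking_le_eq {V : finType} (e : rel V) (h h' : V -> nat) :
    (forall x y, (h' x <= h' y)%N -> (h x <= h y)%N) ->
  ranking e h -> ranking e h'.
Proof.
move=> le_h rk x y hxy xy; apply: rk.
  by apply/eqP; rewrite eqn_leq !le_h ?hxy.
apply: (connect_img (f := id)) xy => a b /and3P[xa xb ab].
by apply: connect1; move: xa xb; rewrite /restr /= !inE ab => /le_h -> /le_h ->.
Qed.

Section Degrees.
Context {V : finType} (e : rel V).

Definition deg (z : V) : nat := #|[set v | e z v]|.

Lemma degE z : deg z = (\sum_v (e z v : nat))%N.
Proof. by rewrite /deg -sum1dep_card big_mkcond; apply: eq_bigr => v _; case: e. Qed.

Lemma card_edges : #|[set p : V * V | e p.1 p.2]| = (\sum_z deg z)%N.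
Proof.
under eq_bigr do rewrite degE.
rewrite pair_big /= -sum1dep_card big_mkcond /=.
by apply: eq_bigr => -[u v] _ /=; case: e.
Qed.

End Degrees.

Lemma sum_bridge {A B : finType} {M : nmodType} (F : option (A + B) -> M) :
  \sum_u F u = F None + (\sum_a F (Some (inl a)) + \sum_b F (Some (inr b))).
Proof. by rewrite big_option big_sumType. Qed.

Section Bridge.
Variables (R : realType) (q d : R) (X Y : inst R) (x : iV X) (y : iV Y).

Definition bridge_rel : rel (option (iV X + iV Y)) := fun u v =>
  match u, v with
  | None, Some (inl a) | Some (inl a), None => a == x
  | None, Some (inr b) | Some (inr b), None => b == y
  | Some (inl a), Some (inl a') => ie X a a'
  | Some (inr b), Some (inr b') => ie Y b b'
  | _, _ => false
  end.

Definition bridge_weight (u : option (iV X + iV Y)) : R :=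
  match u with
  | None => d
  | Some (inl a) => q * iw X a
  | Some (inr b) => q * iw Y b
  end.

(* The connecting vertex [None] will be the unique centroid: its weight [d] makes
   each side together with it heavier than one half (with [2 q + d = 1]). *)
Definition bridge : inst R := Inst bridge_rel bridge_weight.

Lemma sum_eq1 (T : finType) (z : T) : (\sum_v ((v == z) : nat) = 1)%N.
Proof. by rewrite (bigD1 z) //= eqxx big1 // => v /negPf ->. Qed.

Lemma deg_bridge_None : deg bridge_rel None = 2.
Proof. by rewrite degE (sum_bridge (M := nat)) /= !sum_eq1. Qed.

Lemma deg_bridge_inl a : deg bridge_rel (Some (inl a)) = (deg (ie X) a + (a == x))%N.
Proof.
rewrite degE (sum_bridge (M := nat)) /= [X in (_ + (_ + X))%R]big1 // addr0.
by rewrite degE addrC.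
Qed.

Lemma deg_bridge_inr b : deg bridge_rel (Some (inr b)) = (deg (ie Y) b + (b == y))%N.
Proof.
rewrite degE (sum_bridge (M := nat)) /= [X in (_ + (X + _))%R]big1 // add0r.
by rewrite degE addrC.
Qed.

Lemma bridge_sym : symmetric (ie X) -> symmetric (ie Y) -> symmetric bridge_rel.
Proof. by move=> sX sY [[a|b]|] [[a'|b']|] //=; rewrite ?sX ?sY. Qed.

Lemma bridge_connected :
  (forall a b, connect (ie X) a b) -> (forall a b, connect (ie Y) a b) ->
  symmetric (ie X) -> symmetric (ie Y) ->
  forall u v, connect bridge_rel u v.
Proof.
move=> cX cY sX sY.
have cs := sym_connect_sym (bridge_sym sX sY).
have toN u : connect bridge_rel u None.
  case: u => [[a|b]|] //.
    apply: (@connect_trans _ _ (Some (inl x))); last by apply: connect1; rewrite /= eqxx.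
    by apply: (connect_img (f := fun a => Some (inl a))) (cX a x) => ? ? ?; apply: connect1.
  apply: (@connect_trans _ _ (Some (inr y))); last by apply: connect1; rewrite /= eqxx.
  by apply: (connect_img (f := fun b => Some (inr b))) (cY b y) => ? ? ?; apply: connect1.
by move=> u v; apply: connect_trans (toN u) _; rewrite cs.
Qed.

(** With ordered edges counted as a sum of degrees, the join adds one vertex and two edges, that is
    four ordered pairs. *)
Lemma bridge_tree : is_tree (ie X) -> is_tree (ie Y) -> is_tree (ie bridge).
Proof.
case=> sX iX X0 cX EX [sY iY Y0 cY EY]; split.
- exact: bridge_sym.
- by move=> [[a|b]|] //=.
- by rewrite card_option.
- exact: bridge_connected.
- rewrite card_edges (sum_bridge (M := nat)) deg_bridge_None.
  under eq_bigr do rewrite deg_bridge_inl.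
  under [in X in (_ + (_ + X))%R]eq_bigr do rewrite deg_bridge_inr.
  rewrite !big_split /= !sum_eq1 -!card_edges EX EY card_option card_sum.
  move: X0 Y0; rewrite /GRing.add /=; lia.
Qed.

End Bridge.

(** * Costs of rankings and of centroid trees under a join *)

Definition ranking_cost {R : realType} (X : inst R) (h : iV X -> nat) : R :=
  \sum_a iw X a * (h a).+1%:R.

Definition ranking_lb {R : realType} (X : inst R) (b : R) :=
  forall h, ranking (ie X) h -> b <= ranking_cost h.

(** The bound [N] on the labels tells where a connecting vertex can be placed under all of them at
    the next join. *)
Definition ranking_ub {R : realType} (X : inst R) (N : nat) (f : R) :=
  exists h, [/\ ranking (ie X) h, forall a, (h a <= N)%N & ranking_cost h <= f].

Definition rooted_ub {R : realType} (X : inst R) (x : iV X) (N : nat) (f : R) :=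
  exists h, [/\ ranking (ie X) h, h x = 0%N, forall a, (h a <= N)%N & ranking_cost h <= f].

(* Every centroid tree on every copy of [X] in a weighted graph, with weights scaled
   by [s], costs [s * c]; the root depth [d.+1] is left free for the recursion. *)
Definition centroid_cost {R : realType} (X : inst R) (c : R) :=
  forall (V : finType) (e : rel V) (w : V -> R) (f : iV X -> V) (s : R),
    symmetric e -> 0 < s -> injective f ->
    (forall a b, e (f a) (f b) = ie X a b) -> (forall a, w (f a) = s * iw X a) ->
  forall t, is_stree e (f @: [set: iV X]) t -> centroid_nodes e w t ->
  forall d, costd w d.+1 t = s * (c + d%:R).

Section Costs.
Context {R : realType} (X : inst R).
Hypothesis sum1 : \sum_a iw X a = 1.

Lemma ranking_costS (h h' : iV X -> nat) :
  (forall a, h' a = (h a).+1) -> ranking_cost h' = ranking_cost h + 1.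
Proof.
move=> E; rewrite /ranking_cost -[X in _ + X]sum1 -big_split /=.
by apply: eq_bigr => a _; rewrite E -[(h a).+2%:R]natr1 mulrDr mulr1.
Qed.

(** With total weight 1, lowering all labels by one saves exactly 1, and the lowered labels still
    form a ranking. *)
Lemma ranking_lbS b h :
  ranking_lb X b -> ranking (ie X) h -> (forall a, (0 < h a)%N) ->
  b + 1 <= ranking_cost h.
Proof.
move=> lb rk h0; rewrite (@ranking_costS (fun a => (h a).-1)) => [|a]; last first.
  by rewrite prednK.
rewrite lerD2r; apply: lb; apply: ranking_le_eq rk => a b' /=.
by have := h0 a; have := h0 b'; lia.
Qed.

(** Giving [x] the label 0 and raising all other labels by one costs at most the total weight 1. In
    this way any vertex can serve as a hub. *)
Lemma rooted_ubS (x : iV X) N N' f : (forall a, 0 <= iw X a) ->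
  (forall a b, connect (ie X) a b) -> (N < N')%N -> ranking_ub X N f -> rooted_ub x N' (f + 1).
Proof.
move=> w0 cX NN' [h [rk hN hf]]; exists (fun a => if a == x then 0%N else (h a).+1).
rewrite eqxx; split=> // [a b|a|]; last 2 first.
- by case: ifP => // _; apply: leq_trans NN'; rewrite ltnS.
- apply: (@le_trans _ _ (ranking_cost h + 1)); last by rewrite lerD2r.
  rewrite -(@ranking_costS h (fun a => (h a).+1)) //.
  by apply: ler_sum => a _; rewrite ler_wpM2l // ler_nat; case: ifP.
have [->|ax] := eqVneq a x; first by case: eqVneq.
have [->|bx] := eqVneq b x => // -[hab] ab; apply: rk => //.
apply: (connect_img (f := id)) ab => u v /and3P[].
rewrite !inE; case: eqVneq => // _; case: eqVneq => // _ hu hv uv.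
by apply: connect1; rewrite /restr /= !inE uv andbT; apply/andP.
Qed.

End Costs.

Lemma connect_in_setT {V : finType} (e : rel V) (S : {set V}) a b :
  (forall z, z \in S) -> connect e a b -> connect (restr e S) a b.
Proof.
move=> ST; apply: (connect_img (f := id)) => u v uv.
by apply: connect1; rewrite /restr /= !ST.
Qed.

Section BridgeBounds.
Variables (R : realType) (q d : R) (X Y : inst R) (x : iV X) (y : iV Y).
Hypotheses (q0 : 0 < q) (d0 : 0 < d) (qd : 2 * q + d = 1).
Hypotheses (sX : symmetric (ie X)) (sY : symmetric (ie Y)).
Hypotheses (cX : forall a b, connect (ie X) a b) (cY : forall a b, connect (ie Y) a b).
Hypotheses (wX : \sum_a iw X a = 1) (wY : \sum_a iw Y a = 1).
Local Notation G := (bridge q d x y).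

Lemma sum_bridge_weight : \sum_u iw G u = 1.
Proof. by rewrite sum_bridge /= -!mulr_sumr wX wY; have := qd; lra. Qed.

Lemma ranking_cost_bridge h : ranking_cost (X := G) h =
  q * ranking_cost (fun a => h (Some (inl a))) +
  q * ranking_cost (fun b => h (Some (inr b))) + d * (h None).+1%:R.
Proof.
rewrite /ranking_cost sum_bridge /= !mulr_sumr addrC; congr (_ + _ + _);
  by apply: eq_bigr => a _; rewrite mulrA.
Qed.

(** Label 0 occurs at most once, so one side has only positive labels and pays 1 more, scaled by
    [q]; the connecting vertex pays at least [d]. Together this is [q + d = 1 - q]. *)
Lemma ranking_lb_bridge bX bY : ranking_lb X bX -> ranking_lb Y bY ->
  ranking_lb G (q * (bX + bY) + (1 - q)).
Proof.
move=> lbX lbY h rk; rewrite ranking_cost_bridge.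
have rkX : ranking (ie X) (fun a => h (Some (inl a))).
  move=> a b hab ab; suff [] : Some (inl a) = Some (inl b) :> iV G by [].
  apply: rk => //; apply: (connect_img (f := fun a => Some (inl a))) ab => u v.
  by move=> /and3P[hu hv uv]; apply: connect1; move: hu hv; rewrite /restr /= !inE uv => -> ->.
have rkY : ranking (ie Y) (fun b => h (Some (inr b))).
  move=> a b hab ab; suff [] : Some (inr a) = Some (inr b) :> iV G by [].
  apply: rk => //; apply: (connect_img (f := fun a => Some (inr a))) ab => u v.
  by move=> /and3P[hu hv uv]; apply: connect1; move: hu hv; rewrite /restr /= !inE uv => -> ->.
have hN : d <= d * (h None).+1%:R by rewrite ler_pMr // ler1n.
have zero_uniq u v : h u = 0%N -> h v = 0%N -> u = v.
  move=> hu hv; apply: rk; first by rewrite hu hv.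
  apply: connect_in_setT; first by move=> z; rewrite inE hu.
  exact: bridge_connected.
have [[a ha]|na] := pselect (exists a, h (Some (inl a)) = 0%N).
  have hY : bY + 1 <= ranking_cost (fun b => h (Some (inr b))).
    apply: ranking_lbS => // b; rewrite lt0n; apply/eqP => hb.
    by have := zero_uniq _ _ ha hb.
  have := ler_wpM2l (ltW q0) hY; have := ler_wpM2l (ltW q0) (lbX _ rkX).
  by move: hN qd; lra.
have hX : bX + 1 <= ranking_cost (fun a => h (Some (inl a))).
  by apply: ranking_lbS => // a; rewrite lt0n; apply/eqP => ha; apply: na; exists a.
have := ler_wpM2l (ltW q0) hX; have := ler_wpM2l (ltW q0) (lbY _ rkY).
by move: hN qd; lra.
Qed.

Lemma rooted_ub_bridge N N' fX fY : (N'.+2 <= N)%N ->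
    rooted_ub x N fX -> ranking_ub Y N' fY ->
  rooted_ub (X := G) (Some (inl x)) N (q * (fX + fY + 1) + d * N'.+3%:R).
Proof.
move=> N'N [hX [rkX hx hXN hXf]] [hY [rkY hYN hYf]].
(* Labels of [Y] move below the hub, to at most [N' + 1]; the connecting vertex gets the first value
   beyond them, hence depth [N' + 3]. Labels of [X] may coincide with the others, as the hub
   separates them. *)
pose h (u : iV G) := match u with
  | None => N'.+2 | Some (inl a) => hX a | Some (inr b) => (hY b).+1 end.
exists h; split=> //; last 2 first.
- by move=> [[a|b]|] //=; apply: leq_trans N'N; rewrite ltnW // !ltnS.
- rewrite ranking_cost_bridge /=.
  rewrite (ranking_costS wY (h := hY) (h' := fun b => (hY b).+1)) //.
  by rewrite lerD2r -mulrDr ler_pM2l // -addrA lerD // lerD2r.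
have hXx a : hX a = 0%N -> a = x.
  move=> ha; apply: rkX; first by rewrite ha hx.
  by apply: connect_in_setT => // z; rewrite inE ha.
have symG S : connect_sym (restr (ie G) S) by apply/connect_restr_sym/bridge_sym.
pose S k := [set z : iV G | (k <= h z)%N].
(* Among positive labels the hub is missing, so a path that starts in [X] stays in [X]. *)
have toX k a v : (0 < k <= hX a)%N -> connect (restr (ie G) (S k)) (Some (inl a)) v ->
    exists2 b, v = Some (inl b) & connect (restr (ie X) [set z | (k <= hX z)%N]) a b.
  case/andP=> k0 ka av.
  pose A : {set iV G} := [set v | if v is Some (inl b) then
     (k <= hX b)%N && connect (restr (ie X) [set z | (k <= hX z)%N]) a b else false].
  have : v \in A; last by rewrite inE; case: v {av} => [[b|]|] // /andP[_ ab]; exists b.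
  apply: closed_set_connect av; [exact: bridge_sym| |by rewrite inE ka connect0].
  move=> [[b|b]|] [[b'|b']|] //; rewrite !inE // => /andP[kb ab].
    move=> kb' bb'; rewrite kb'; apply: connect_trans ab _.
    by apply: connect1; rewrite /restr /= !inE kb kb'.
  by move=> _ /eqP bx; move: kb; rewrite bx hx leqNgt k0.
(* Off the root, the connecting vertex is a leaf, which can be retracted to [y]. *)
have toY k b v : connect (restr (ie G) (S k)) (Some (inr b)) v ->
    if v is Some (inr b') then
      connect (restr (ie Y) [set z | (k <= (hY z).+1)%N]) b b' else true.
  pose f (v : iV G) := if v is Some (inr b') then b' else y.
  move=> bv; suff : connect (restr (ie Y) [set z | (k <= (hY z).+1)%N]) b (f v).
    by case: v bv => [[|]|].
  apply: (connect_img (f := f)) bv => {v} [[[a|c]|] [[a'|c']|]] //=;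
    rewrite /restr /= !inE => /and3P[ha hb] // ab; rewrite ?(eqP ab) //.
  by apply: connect1; rewrite /= !inE; apply/and3P.
move=> u v huv uv; have [hu|hu] := posnP (h u).
  have zero z : h z = 0%N -> z = Some (inl x) by case: z => [[a|b]|] //= /hXx ->.
  by rewrite (zero _ hu) (zero v) // -huv.
case: u v huv uv hu => [[a|b]|] [[a'|b']|] //= huv uv hu.
- have [|c [Ec] ac] := toX _ _ _ _ uv; first by rewrite hu /=.
  by congr (Some (inl _)); apply: rkX => //; rewrite Ec.
- by have [|] := toX _ _ _ _ uv; first by rewrite hu /=.
- by have [|] := toX _ _ _ _ uv; first by rewrite hu /=.
- rewrite symG in uv; have [|//] := toX _ _ _ _ uv; by rewrite hu /= huv.
- case: huv => huv; congr (Some (inr _)); exact: rkY (toY _ _ _ uv).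
- by have := hYN b; rewrite -ltnS huv ltnn.
- rewrite symG in uv; have [|//] := toX _ _ _ _ uv; by rewrite hu /= huv.
- by have := hYN b'; rewrite -ltnS -huv ltnn.
Qed.

Lemma centroid_bridge (V : finType) (e : rel V) (w : V -> R) (f : iV G -> V) (s : R) v :
    symmetric e -> 0 < s -> injective f ->
    (forall a b, e (f a) (f b) = ie G a b) -> (forall a, w (f a) = s * iw G a) ->
    (forall a, 0 <= iw X a) -> (forall b, 0 <= iw Y b) ->
  is_centroid e w (f @: [set: iV G]) v -> v = f None.
Proof.
move=> se s0 fI fe fw wX0 wY0 [/imsetP[u _ ->] Hu].
have fw0 z : 0 <= w (f z).
  rewrite fw; apply: mulr_ge0; first exact: ltW.
  by case: z => [[a|b]|] /=; rewrite ?mulr_ge0 ?(ltW q0) ?(ltW d0).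
pose S := f @: [set: iV G] :\ f u.
have wS : wsum w (f @: [set: iV G]) = s.
  rewrite /wsum big_imset /=; last by move=> ? ? _ _; apply: fI.
  rewrite (eq_bigl xpredT) => [|z]; last by rewrite inE.
  by under eq_bigr do rewrite fw; rewrite -mulr_sumr sum_bridge_weight mulr1.
(* One side of the bridge together with the connecting vertex is connected and
   outweighs one half. *)
have heavy (A : {set iV G}) : None \in A -> u \notin A ->
    (forall z, z \in A -> connect (restr (ie G) A) None z) ->
    q + d <= \sum_(z in A) iw G z -> u = None.
  move=> NA uA cA wA; exfalso.
  have AS z : z \in A -> f z \in S.
    by move=> zA; rewrite !inE (inj_eq fI) imset_f ?inE // andbT; apply: contraNneq uA => <-.
  have := Hu _ (comp_in_components e (AS _ NA)); rewrite wS.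
  have : s * (q + d) <= wsum w (Defs.comp e S (f None)).
    apply: (@le_trans _ _ (wsum w (f @: A))).
      rewrite /wsum big_imset /=; last by move=> ? ? _ _; apply: fI.
      by under eq_bigr do rewrite fw; rewrite -mulr_sumr ler_pM2l.
    have sub : f @: A \subset Defs.comp e S (f None).
      apply/fintype.subsetP => _ /imsetP[z zA ->]; rewrite inE AS //=.
      apply: (connect_img (f := f)) (cA _ zA) => a b /and3P[aA bA ab].
      by apply: connect1; rewrite /restr /= !AS // fe.
    rewrite /wsum [leRHS](big_setID (f @: A)) /= (finset.setIidPr sub) lerDl.
    apply: sumr_ge0 => z; rewrite !inE => /and3P[_ /andP[_ /imsetP[a _ ->]] _].
    exact: fw0.
  (* Since [2 (q + d) = 1 + d], this component weighs more than [s / 2]. *)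
  move=> h1 h2; have := le_trans h1 h2; have := mulr_gt0 s0 d0.
  by move: qd => /(congr1 ( *%R s)); lra.
case: u {S Hu} heavy => [[a|b]|] // heavy.
  suff : Some (inl a) = None :> iV G by [].
  apply: (heavy [set z | if z is Some (inl _) then false else true]); rewrite ?inE //.
    move=> [[a'|b]|]; rewrite ?inE // => _.
    apply: (@connect_trans _ _ (Some (inr y))).
      by apply: connect1; rewrite /restr /= !inE eqxx.
    apply: (connect_img (f := fun b => Some (inr b))) (cY y b) => ? ? ?.
    by apply: connect1; rewrite /restr /= !inE.
  rewrite big_mkcond sum_bridge /= !inE [X in _ + (X + _)]big1 => [|c]; last by rewrite inE.
  under eq_bigr do rewrite inE.
  by rewrite -mulr_sumr wY; lra.
suff : Some (inr b) = None :> iV G by [].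
apply: (heavy [set z | if z is Some (inr _) then false else true]); rewrite ?inE //.
  move=> [[a|b']|]; rewrite ?inE // => _.
  apply: (@connect_trans _ _ (Some (inl x))).
    by apply: connect1; rewrite /restr /= !inE eqxx.
  apply: (connect_img (f := fun a => Some (inl a))) (cX x a) => ? ? ?.
  by apply: connect1; rewrite /restr /= !inE.
rewrite big_mkcond sum_bridge /= !inE [X in _ + (_ + X)]big1 => [|c]; last by rewrite inE.
under eq_bigr do rewrite inE.
by rewrite -mulr_sumr wX; lra.
Qed.

End BridgeBounds.

Section BridgeCentroidCost.
Variables (R : realType) (q d : R) (X Y : inst R) (x : iV X) (y : iV Y).
Hypotheses (q0 : 0 < q) (d0 : 0 < d) (qd : 2 * q + d = 1).
Hypotheses (cX : forall a b, connect (ie X) a b) (cY : forall a b, connect (ie Y) a b).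
Hypotheses (wX : \sum_a iw X a = 1) (wY : \sum_a iw Y a = 1).
Hypotheses (wX0 : forall a, 0 <= iw X a) (wY0 : forall b, 0 <= iw Y b).
Local Notation G := (bridge q d x y).

(** The root must be the connecting vertex, and the two components left are copies of [X] and [Y] at
    scale [s * q], one level deeper. As [2 q + d = 1], the total weight [s] pays for the root level,
    which gives the summand 1. *)
Lemma centroid_cost_bridge a b : centroid_cost X a -> centroid_cost Y b ->
  centroid_cost G (1 + q * (a + b)).
Proof.
move=> CX CY V e w f s se s0 fI fe fw [r ch] St cn n.
have rE : r = f None.
  have /centroid_nodesE[cr _] := cn.
  rewrite (vset_stree se St) in cr.
  exact: (centroid_bridge q0 d0 qd cX cY wX wY se s0 fI fe fw wX0 wY0 cr).
pose fX z := f (Some (inl z)); pose fY z := f (Some (inr z)).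
pose A := fX @: [set: iV X]; pose B := fY @: [set: iV Y].
pose S := f @: [set: iV G] :\ f None.
have fS z : z != None -> f z \in S.
  by move=> zN; rewrite !inE (inj_eq fI) zN imset_f.
have cA z : Defs.comp e S (fX z) = A.
  apply: comp_closed_set => //; rewrite ?imset_f //.
  - by apply/fintype.subsetP => _ /imsetP[z' _ ->]; apply: fS.
  - move=> _ /imsetP[z' _ ->]; apply: (connect_img (f := fX)) (cX z z') => ? ? ?.
    by apply: connect1; rewrite /restr /= !fS // fe.
  - move=> u0 v /imsetP[z1 _ ->] /setD1P[+ /imsetP[u _ vE]]; rewrite {v}vE fe.
    case: u => [[u|u]|] //=; first by move=> _ _; apply: imset_f.
    by rewrite eqxx.
have cB z : Defs.comp e S (fY z) = B.
  apply: comp_closed_set => //; rewrite ?imset_f //.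
  - by apply/fintype.subsetP => _ /imsetP[z' _ ->]; apply: fS.
  - move=> _ /imsetP[z' _ ->]; apply: (connect_img (f := fY)) (cY z z') => ? ? ?.
    by apply: connect1; rewrite /restr /= !fS // fe.
  - move=> u0 v /imsetP[z1 _ ->] /setD1P[+ /imsetP[u _ vE]]; rewrite {v}vE fe.
    case: u => [[u|u]|] //=; first by move=> _ _; apply: imset_f.
    by rewrite eqxx.
have compsE : components e S = [set A; B].
  apply/finset.setP => K; rewrite in_set2; apply/imsetP/orP => [[v vS ->]|].
    case/setD1P: vS => + /imsetP[u _ vE]; rewrite {v}vE.
    case: u => [[u|u]|]; last by case/eqP.
      by move=> _; left; rewrite cA.
    by move=> _; right; rewrite cB.
  by case=> /eqP->; [exists (fX x)|exists (fY y)]; rewrite ?cA ?cB // fS.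
have AB : A != B.
  apply/negP => /eqP AB; have : fX x \in B by rewrite -AB imset_f.
  by case/imsetP => z _ /fI.
pose g K := if K == A then s * q * (a + n.+1%:R) else s * q * (b + n.+1%:R).
rewrite (stree_node_cost (w := w) (G := g) St).
  rewrite rE -/S compsE big_setU1 ?inE //= big_set1 /g eqxx eq_sym (negPf AB) fw /=.
  have -> : n.+1%:R = 1 + n%:R :> R by rewrite nat1r.
  have -> : d = 1 - 2 * q by move: qd; lra.
  by ring.
have /is_streeE[_ _ chS Hch] := St.
have /centroid_nodesE[_ Cch] := cn.
move=> c cch; have := In_mem_vset cch.
have -> : (vset c \in map (@vset V) ch) = (vset c \in [set A; B]).
  by rewrite -compsE /S -rE -chS inE.
have Stc := Hch c cch; have Cc := Cch c cch.
rewrite in_set2 /g => /orP[]/eqP Ec; rewrite Ec.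
  rewrite eqxx; apply: (CX V e w fX (s * q)) => //; rewrite -/A -?Ec //.
  - exact: mulr_gt0.
  - by move=> ? ? /fI[].
  - by move=> ? ?; rewrite fe.
  - by move=> ?; rewrite fw /= mulrA.
rewrite eq_sym (negPf AB); apply: (CY V e w fY (s * q)) => //; rewrite -/B -?Ec //.
- exact: mulr_gt0.
- by move=> ? ? /fI[].
- by move=> ? ?; rewrite fe.
- by move=> ?; rewrite fw /= mulrA.
Qed.

End BridgeCentroidCost.

(** * The one-vertex instance *)

Section Singleton.
Variable R : realType.

Definition singleton : inst R := @Inst R unit (fun _ _ => false) (fun=> 1).

Lemma singleton_deg z : deg (ie singleton) z = 0%N.
Proof. by rewrite degE big1. Qed.

Lemma singleton_tree : is_tree (ie singleton).
Proof.
split=> //; rewrite ?card_unit //; first by move=> [] [].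
by rewrite card_edges big1 // => z _; apply: singleton_deg.
Qed.

Lemma singleton_sum : \sum_a iw singleton a = 1.
Proof. by rewrite (bigD1 tt) //= big1 ?addr0 // => -[]. Qed.

Lemma singleton_ranking_cost (h : iV singleton -> nat) : ranking_cost h = (h tt).+1%:R.
Proof. by rewrite /ranking_cost (bigD1 tt) //= big1 ?addr0 ?mul1r // => -[]. Qed.

Lemma singleton_ranking_lb : ranking_lb singleton 1.
Proof. by move=> h _; rewrite singleton_ranking_cost ler1n. Qed.

Lemma singleton_rooted_ub N : rooted_ub (X := singleton) tt N 1.
Proof. by exists (fun=> 0%N); split=> //; [move=> [] []|rewrite singleton_ranking_cost]. Qed.

Lemma singleton_centroid_cost : centroid_cost singleton 1.
Proof.
move=> V e w f s se s0 fI fe fw [r ch] St _ n.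
have SE : f @: [set: iV singleton] = [set f tt].
  apply/finset.setP => v; rewrite inE; apply/imsetP/eqP => [[[] _ ->]//|->].
  by exists tt; rewrite ?inE.
have /is_streeE[+ _ _ _] := St; rewrite SE inE => /eqP rE.
rewrite (stree_node_cost (w := w) (G := fun=> 0) St).
  by rewrite big1 // addr0 rE fw mulr1 nat1r.
have /is_streeE[_ _ chS _] := St.
move=> c /In_mem_vset cch; exfalso.
have : vset c \in components e (f @: [set: iV singleton] :\ r) by rewrite -chS inE.
by rewrite SE rE finset.setDv => /imsetP[z]; rewrite inE.
Qed.

End Singleton.

(** * Iterated joins *)

(** The invariant of the construction: [c] is the exact cost of centroid trees, while [b] only
    bounds the optimum from below. *)
Record good {R : realType} (X : inst R) (c b : R) : Prop := Good {
  good_tree : is_tree (ie X);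
  good_ge0 : forall a, 0 <= iw X a;
  good_sum1 : \sum_a iw X a = 1;
  good_centroid : centroid_cost X c;
  good_lb : ranking_lb X b }.

(* Copies of an instance are attached at [a]; [l] is a leaf (unless the instance is
   a single vertex), at which the instance can serve as a hub. *)
Record marked {R : realType} (D : nat) (X : inst R) (a l : iV X) : Prop := Marked {
  marked_deg : forall z, (deg (ie X) z <= D)%N;
  marked_attach : (deg (ie X) a < D)%N;
  marked_leaf : (deg (ie X) l + (l == a) <= 1)%N }.

Lemma good_OPT {R : realType} (X : inst R) c b N f :
    good X c b -> ranking_ub X N f ->
  b <= OPT (ie X) (iw X) <= f.
Proof.
case=> -[sX _ X0 cX _] w0 _ _ lb [h [rk _ hf]]; apply/andP; split.
  exact: OPT_ge_ranking.
exact: le_trans (OPT_le_ranking sX cX X0 w0 rk) hf.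
Qed.

Lemma good_centroid_cost {R : realType} (X : inst R) c b t :
  good X c b -> centroid_tree (ie X) (iw X) t -> cost (iw X) t = c.
Proof.
case=> -[sX _ _ _ _] _ _ cc _ [St cn].
rewrite /cost (cc _ (ie X) (iw X) id 1) ?ltr01 ?mul1r ?addr0 //.
  by move=> a; rewrite mul1r.
by rewrite imset_id.
Qed.

Lemma singleton_good (R : realType) : good (singleton R) 1 1.
Proof.
split; [exact: singleton_tree|by move=> ?; apply: ler01|exact: singleton_sum| |].
  exact: singleton_centroid_cost.
exact: singleton_ranking_lb.
Qed.

Lemma singleton_marked (R : realType) D : (0 < D)%N -> @marked R D (singleton R) tt tt.
Proof. by move=> D0; split=> [z||]; rewrite singleton_deg. Qed.

Section Families.
Context {R : realType} (q d : R).
Hypotheses (q0 : 0 < q) (d0 : 0 < d) (qd : 2 * q + d = 1).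

Lemma good_bridge (X Y : inst R) (x : iV X) (y : iV Y) cX bX cY bY :
  good X cX bX -> good Y cY bY ->
  good (bridge q d x y) (1 + q * (cX + cY)) (q * (bX + bY) + (1 - q)).
Proof.
move=> [tX X0 X1 ccX lbX] [tY Y0 Y1 ccY lbY].
have [sX _ _ cnX _] := tX; have [sY _ _ cnY _] := tY.
split.
- exact: bridge_tree.
- by case=> [[a|b]|] /=; rewrite ?mulr_ge0 ?(ltW q0) ?(ltW d0).
- exact: sum_bridge_weight.
- exact: centroid_cost_bridge.
- exact: ranking_lb_bridge.
Qed.

(** The sum [1 + q + ... + q^(k-1)] in closed form. *)
Definition geom (k : nat) : R := (1 - q ^+ k) / (1 - q).

Lemma q_lt1 : q < 1.
Proof. by move: q0 d0 qd; lra. Qed.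

Lemma geomM k : geom k * (1 - q) = 1 - q ^+ k.
Proof. by rewrite /geom divfK // subr_eq0 gt_eqF // q_lt1. Qed.

Lemma geomS k : geom k.+1 = 1 + q * geom k.
Proof.
have h : 1 - q != 0 by rewrite subr_eq0 gt_eqF // q_lt1.
by rewrite /geom exprS; field.
Qed.

(** Induction on the number of copies of [Y]: each join scales the star built so far by [q], so [M]
    ends with weight [q^k], while the hub keeps label 0 and gains one neighbour. *)
Lemma star_exists (M Y : inst R) (m : iV M) (y : iV Y) D N N' cM bM fM cY bY fY k :
    good M cM bM -> rooted_ub m N fM -> (forall z, (deg (ie M) z <= D)%N) ->
    good Y cY bY -> ranking_ub Y N' fY -> (forall z, (deg (ie Y) z <= D)%N) ->
    (deg (ie Y) y < D)%N -> (2 <= D)%N -> (N'.+2 <= N)%N ->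
    (deg (ie M) m + k <= D)%N ->
  exists (X : inst R) (x : iV X),
    [/\ good X (q ^+ k * cM + geom k * (1 + q * cY))
               (q ^+ k * bM + geom k * (q * bY + (1 - q))),
        rooted_ub x N (q ^+ k * fM + geom k * (q * (fY + 1) + d * N'.+3%:R)),
        forall z, (deg (ie X) z <= D)%N & (deg (ie X) x = deg (ie M) m + k)%N].
Proof.
move=> gM uM dM gY uY dY dy D2 NN'; elim: k => [|k IH] dm.
  exists M, m; rewrite addn0 /geom expr0 subrr !mul0r !addr0 !mul1r; split=> //.
have [|X [x [gX uX dX dx]]] := IH; first lia.
exists (bridge q d x y), (Some (inl x)); split.
- have := good_bridge x y gX gY; rewrite geomS exprS.
  by congr good; ring.
- have [[sX _ _ cnX _] _ _ _ _] := gX; have [[sY _ _ _ _] _ Y1 _ _] := gY.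
  have := rooted_ub_bridge d y q0 sX sY cnX Y1 NN' uX uY; rewrite geomS exprS.
  by congr rooted_ub; ring.
- case=> [[a|b]|] /=; rewrite ?deg_bridge_inl ?deg_bridge_inr ?deg_bridge_None //.
    by have := dX a; case: eqP => [->|] /=; rewrite ?dx; lia.
  by have := dY b; case: eqP => [->|] /=; move: dy; lia.
- by rewrite deg_bridge_inl eqxx dx /=; lia.
Qed.

End Families.

Lemma addn_pred_le x y D : (x + y <= 1)%N -> (0 < D)%N -> (x + D.-1 <= D)%N.
Proof. lia. Qed.

(** * Growing families of instances *)

Section Growth.
Context {R : realType} (q d : R).
Hypotheses (q0 : 0 < q) (d0 : 0 < d) (qd : 2 * q + d = 1).
Local Notation geom := (geom q).

(** The last join is made separately: its connecting vertex, of degree 2, becomes the new attachment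
    vertex, and [l] in the last copy the new leaf. If [l] was the attachment vertex, the join raises
    its degree, which is why the leaf condition counts [l == a]. *)
Lemma grow_exists (M Y : inst R) (m : iV M) (a l : iV Y) D N' cM bM fM cY bY fY k :
    good M cM bM -> rooted_ub m N'.+2 fM -> (forall z, (deg (ie M) z <= D)%N) ->
    good Y cY bY -> ranking_ub Y N' fY -> marked D a l -> (3 <= D)%N ->
    (0 < k)%N -> (deg (ie M) m + k <= D)%N ->
  exists (X : inst R) (a' l' : iV X),
    [/\ good X (q ^+ k * cM + geom k * (1 + q * cY))
               (q ^+ k * bM + geom k * (q * bY + (1 - q))),
        ranking_ub X N'.+2 (q ^+ k * fM + geom k * (q * (fY + 1) + d * N'.+3%:R)) &
        marked D a' l'].
Proof.
move=> gM uM dM gY uY [dY da dl] D3; case: k => // k _ dm.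
have [||X [x [gX uX dX dx]]] :=
  star_exists q0 d0 qd gM uM dM gY uY dY da _ (leqnn _) (k := k).
- exact: leq_trans D3.
- by rewrite -ltnS -addnS ltnW.
have [[sX _ _ cnX _] _ _ _ _] := gX; have [[sY _ _ _ _] _ Y1 _ _] := gY.
exists (bridge q d x a), None, (Some (inr l)); split.
- have := good_bridge q0 d0 qd x a gX gY; rewrite (geomS q0 d0 qd) exprS.
  by congr good; ring.
- have [h [rk _ hN hf]] := rooted_ub_bridge d a q0 sX sY cnX Y1 (leqnn _) uX uY.
  exists h; split=> //; move: hf; rewrite (geomS q0 d0 qd) exprS.
  by congr (_ <= _); ring.
split=> [[[b|b]|]||]; rewrite ?deg_bridge_inl ?deg_bridge_inr ?deg_bridge_None //=.
- by have := dX b; case: eqP => [->|] /=; rewrite ?dx; lia.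
- by have := dY b; case: eqP => [->|] /=; move: da; lia.
- exact: leq_trans D3.
- by rewrite addn0.
Qed.

Lemma q_le_half : q <= 1 / 2.
Proof. by move: q0 d0 qd; lra. Qed.

Lemma geom_ge0 k : 0 <= geom k.
Proof.
apply: divr_ge0; rewrite subr_ge0 ?(ltW (q_lt1 q0 d0 qd)) //.
by apply: exprn_ile1; [exact: ltW|exact: ltW (q_lt1 q0 d0 qd)].
Qed.

Lemma geom_le2 k : geom k <= 2.
Proof.
rewrite ler_pdivrMr ?subr_gt0 ?(q_lt1 q0 d0 qd) //.
have : 0 <= q ^+ k by apply/exprn_ge0/ltW.
by move: q_le_half; lra.
Qed.

(** With [s = q * geom D], one step maps [b] to [1 + s b] and [c] to [1 + s + s c], so from the
    start [b = c = 1] the gap [(1 + s) b - c] is multiplied by [s] each time. The upper bound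
    follows the recursion of [b] with an additive error at most [o], which yields the factor
    [1 + o]. *)
Lemma bounded_family (D n : nat) (o : R) : (3 <= D)%N ->
    (2 * d * (2 * n + 2)%:R <= o) -> forall k, (k <= n)%N ->
  exists (X : inst R) (a l : iV X) (b f : R),
    [/\ good X ((1 + q * geom D) * b - (q * geom D) ^+ k.+1) b,
        ranking_ub X (2 * k) f, marked D a l, 1 <= b & f <= (1 + o) * b].
Proof.
move=> D3 ho; have o0 : 0 <= o by apply: le_trans ho; rewrite !mulr_ge0 // ltW.
elim=> [|k IH] kn.
  exists (singleton R), tt, tt, 1, 1; rewrite expr1; split=> //.
  - by have := singleton_good R; congr good; ring.
  - by have [h [? _ ? ?]] := singleton_rooted_ub R 0; exists h.
  - by apply: singleton_marked; apply: leq_trans D3.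
  - by rewrite mulr1 lerDl.
have [X [a [l [b [f [gX uX mX b1 fb]]]]]] := IH (ltnW kn).
have [|||X' [a' [l' [gX' uX' mX']]]] := @grow_exists (singleton R) X tt a l D (2 * k)
  _ _ _ _ _ _ D (singleton_good R) (singleton_rooted_ub R _) _ gX uX mX D3.
- by move=> z; rewrite singleton_deg.
- exact: leq_trans D3.
- by rewrite singleton_deg.
move: (geom D) (geom_ge0 D) (geom_le2 D) (geomM q0 d0 qd D) gX' uX' => g g0 g2 gE gX' uX'.
exists X', a', l', (1 + q * g * b), (q ^+ D * 1 + g * (q * (f + 1) + d * (2 * k).+3%:R)).
have qDE : q ^+ D = 1 - g * (1 - q) by rewrite gE; ring.
have dE : d = 1 - 2 * q by move: qd; lra.
split=> //.
- move: gX'; rewrite qDE; congr good; last by ring.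
  by rewrite [in RHS]exprS; ring.
- by move: uX'; rewrite mulnS.
- by rewrite lerDl; apply: mulr_ge0; [apply: mulr_ge0; [exact: ltW|]|apply: le_trans b1].
have hk : d * g * (2 * k + 2)%:R <= o.
  apply: le_trans ho; rewrite [d * g]mulrC -!mulrA.
  apply: ler_pM => //; first by rewrite mulr_ge0 // ltW.
  by rewrite ler_pM2l // ler_nat leq_add2r leq_mul2l ltnW.
have -> : (2 * k).+3%:R = (2 * k + 2)%:R + 1 :> R by rewrite addn2 natr1.
have -> : q ^+ D * 1 + g * (q * (f + 1) + d * ((2 * k + 2)%:R + 1)) =
    1 + q * g * f + d * g * (2 * k + 2)%:R by rewrite qDE dE; ring.
have qg0 : 0 <= q * g by rewrite mulr_ge0 // ltW.
have := ler_wpM2l qg0 fb; have := mulr_ge0 (mulr_ge0 qg0 o0) (le_trans ler01 b1).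
move: hk; lra.
Qed.

(** The quantity [c - t * f] is followed directly: with [g = geom D.-1], a step multiplies it by
    [1 - d * g] and then loses at most [e], which is small when [t] is close to [g]. *)
Lemma unbounded_family (D n : nat) (t e : R) : (3 <= D)%N -> 1 <= t <= 2 ->
    2 * d * n%:R <= 1 -> 0 <= e -> t - geom D.-1 + 2 * t * d * (2 * n + 2)%:R <= e ->
  forall k, (k <= n)%N ->
  exists (X : inst R) (a l : iV X) (c b f : R),
    [/\ good X c b, ranking_ub X (2 * k) f, marked D a l, k%:R / 4 <= b &
        1 - t - k%:R * e <= c - t * f].
Proof.
move=> D3 /andP[t1 t2] hn e0 he; elim=> [|k IH] kn.
  exists (singleton R), tt, tt, 1, 1, 1; split.
  - exact: singleton_good.
  - by have [h [? _ ? ?]] := singleton_rooted_ub R 0; exists h.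
  - by apply: singleton_marked; apply: leq_trans D3.
  - by rewrite mul0r ler01.
  - by rewrite mul0r subr0 mulr1.
have [X [a [l [c [b [f [gX uX mX hb hc]]]]]]] := IH (ltnW kn).
have [[_ _ _ cnX _] w0 X1 _ _] := gX.
(* The hub is the marked leaf of a further copy: removing it first costs 1, and its degree of at
   most 1 leaves room for [D - 1] joins. *)
have uM := rooted_ubS X1 l w0 cnX (leqnSn (2 * k).+1) uX.
have [||X' [a' [l' [gX' uX' mX']]]] := @grow_exists X X l a l D (2 * k)
  _ _ _ _ _ _ D.-1 gX uM (marked_deg mX) gX uX mX D3.
- by case: (D) D3 => [|[]].
- by apply: addn_pred_le (marked_leaf mX) _; apply: leq_trans D3.
have qD1 : q ^+ D.-1 <= q.
  rewrite -[leRHS]expr1; apply: ler_wiXn2l; [exact: ltW|exact: ltW (q_lt1 q0 d0 qd)|].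
  by case: (D) D3 => [|[]].
move: (geom D.-1) (geom_ge0 D.-1) (geom_le2 D.-1) (geomM q0 d0 qd D.-1) he IH gX' uX'
  => g g0 g2 gE he _ gX' uX'.
have Q0 : 0 <= q ^+ D.-1 by apply/exprn_ge0/ltW.
move: (q ^+ D.-1) Q0 gE gX' uX' qD1 => Q Q0 gE gX' uX' qD1.
exists X', a', l', (Q * c + g * (1 + q * c)), (Q * b + g * (q * b + (1 - q))),
  (Q * (f + 1) + g * (q * (f + 1) + d * (2 * k).+3%:R)).
have QE : Q = 1 - g * (1 - q) by rewrite gE; ring.
have dE : d = 1 - 2 * q by move: qd; lra.
have dg0 : 0 <= d * g by rewrite mulr_ge0 // ltW.
have kn' : k%:R <= n%:R :> R by rewrite ler_nat ltnW.
(* This limits the loss [d g k / 4] in the lower bound to [1 / 4]; the gain [1 - Q] is at least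
   [1 / 2], so a net growth of [1 / 4] remains. *)
have dgk : d * g * k%:R <= 1.
  apply: le_trans hn; rewrite [d * g]mulrC -!mulrA; apply: ler_pM => //.
    by rewrite mulr_ge0 // ltW.
  by rewrite ler_pM2l.
have S0 : 0 <= 1 - d * g.
  have -> : 1 - d * g = Q + g * q by rewrite QE dE; ring.
  by rewrite addr_ge0 ?mulr_ge0 // ltW.
split; [exact: gX'|by move: uX'; rewrite mulnS|exact: mX'| |].
  have -> : Q * b + g * (q * b + (1 - q)) = (1 - d * g) * b + (1 - Q).
    by rewrite QE dE; ring.
  have := ler_wpM2l S0 hb; have := q_le_half; rewrite -[k.+1%:R]natr1.
  by move: dgk qD1; lra.
have -> : (2 * k).+3%:R = (2 * k + 2)%:R + 1 :> R by rewrite addn2 natr1.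
have -> : Q * c + g * (1 + q * c) -
    t * (Q * (f + 1) + g * (q * (f + 1) + d * ((2 * k + 2)%:R + 1))) =
    (1 - d * g) * (c - t * f) + (g - t - t * (d * g * (2 * k + 2)%:R)).
  by rewrite QE dE; ring.
have he' : t - g + t * (d * g * (2 * k + 2)%:R) <= e.
  apply: le_trans he; rewrite lerD2l [2 * t]mulrC -!mulrA ler_wpM2l //.
    exact: le_trans t1.
  rewrite !mulrA [d * g]mulrC -!mulrA; apply: ler_pM => //.
    by rewrite mulr_ge0 // ltW.
  by rewrite ler_pM2l // ler_nat leq_add2r leq_mul2l ltnW.
have := ler_wpM2l S0 hc; have k0 : 0 <= k%:R :> R := ler0n _ _.
(* As [1 - t - k e <= 0], multiplying it by [1 - d g] can only increase it. *)
have := mulr_ge0 dg0 (addr_ge0 (mulr_ge0 k0 e0) (_ : 0 <= t - 1)).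
rewrite subr_ge0 => /(_ t1); rewrite -[k.+1%:R]natr1.
by move: he'; lra.
Qed.

End Growth.

(** * Choice of the parameters *)

Section GeometricSums.
Context {R : realType} (q d : R).
Hypotheses (q0 : 0 < q) (d0 : 0 < d) (qd : 2 * q + d = 1).

(** For [q = 1 / 2] the value would be the upper bound. In a step from [s] to [q (1 + s)] the
    inherited error is halved and at most [d] is added, so [2 d] bounds it throughout. *)
Lemma geom_half_bounds k :
  1 - 1 / 2 ^+ k - 2 * d <= q * geom q k <= 1 - 1 / 2 ^+ k.
Proof.
elim: k => [|k /andP[lo hi]].
  by rewrite /geom !expr0 divr1 !subrr mul0r mulr0 lexx andbT; move: d0; lra.
rewrite (geomS q0 d0 qd) exprS invfM mulrA.
have p0 : 0 <= 1 / 2 ^+ k :> R by rewrite divr_ge0.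
have -> : 1 / 2 * (2 ^+ k)^-1 = 1 / 2 * (1 / 2 ^+ k) :> R by rewrite [1 / 2 ^+ k]mul1r.
move: (1 / 2 ^+ k) p0 lo hi => p p0 lo hi.
have g0 := mulr_ge0 (ltW q0) (geom_ge0 q0 d0 qd k).
move: (q * geom q k) g0 lo hi => s s0 lo hi.
have qE : q = (1 - d) / 2 by move: qd; lra.
rewrite {1 2}qE; have ds := mulr_ge0 (ltW d0) s0.
have : 0 <= d * (1 - s) by rewrite mulr_ge0 ?(ltW d0) //; move: p0 hi; lra.
by move: d0 => d0' ds'; apply/andP; split; lra.
Qed.

End GeometricSums.

Lemma bounded_instance (R : realType) (D n : nat) : (3 <= D)%N ->
  let h : R := n.+1%:R^-1 in
  exists X : inst R, [/\ is_tree (ie X), max_deg_le (ie X) D, forall a, 0 <= iw X a &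
    forall C, centroid_tree (ie X) (iw X) C ->
    (2 - 1 / 2 ^+ D - h ^+ 2 / 2 - (1 - 1 / 2 ^+ D) ^+ n.+1) / (1 + h)
      <= cost (iw X) C / OPT (ie X) (iw X) <= 2 - 1 / 2 ^+ D].
Proof.
move=> D3 h; have h0 : 0 < h by rewrite invr_gt0 ltr0n.
have h1 : h <= 1 by rewrite invf_le1 ?ltr0n // ler1n.
(* This makes [2 d (2 n + 2)] exactly [h], and the error [2 d] of the geometric sum equal to
   [h^2 / 2]; both vanish in the limit. *)
pose d := h ^+ 2 / 4; pose q := (1 - d) / 2.
have d0 : 0 < d by rewrite divr_gt0 // exprn_gt0.
have d1 : d <= 1 / 4 by rewrite /d; nra.
have q0 : 0 < q by rewrite /q; move: d1; lra.
have qd : 2 * q + d = 1 by rewrite /q; lra.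
have ho : 2 * d * (2 * n + 2)%:R <= h.
  rewrite (_ : (2 * n + 2)%N = (2 * n.+1)%N); last by rewrite mulnS addnC.
  rewrite natrM /d -[n.+1%:R]invrK -/h le_eqVlt; apply/orP; left; apply/eqP.
  by field; exact: lt0r_neq0.
have [X [a [l [b [f [gX uX mX b1 fb]]]]]] := bounded_family q0 d0 qd D3 ho (leqnn n).
have [tX w0 _ _ _] := gX.
exists X; split=> //; first by move=> z; apply: (marked_deg mX).
move=> C cC; rewrite (good_centroid_cost gX cC).
have /andP[bO Of] := good_OPT gX uX.
have /andP[lo hi] := geom_half_bounds q0 d0 qd D.
have s0 := mulr_ge0 (ltW q0) (geom_ge0 q0 d0 qd D).
move: (q * geom q D) s0 lo hi {gX} => s s0 lo hi.
have b0 : 0 < b by apply: lt_le_trans b1.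
have O0 : 0 < OPT (ie X) (iw X) by apply: lt_le_trans bO.
have hp : s ^+ n.+1 <= (1 - 1 / 2 ^+ D) ^+ n.+1 by rewrite lerXn2r // nnegrE (le_trans s0).
have sp : 0 <= s ^+ n.+1 by rewrite exprn_ge0.
apply/andP; split; last first.
  rewrite ler_pdivrMr //.
  have := ler_wpM2l (addr_ge0 ler01 s0) bO.
  have : s * OPT (ie X) (iw X) <= (1 - 1 / 2 ^+ D) * OPT (ie X) (iw X) by rewrite ler_pM2r.
  by move: sp; lra.
rewrite ler_pdivrMr ?addr_gt0 // [leRHS]mulrAC ler_pdivlMr //.
set A := 2 - _ - _ - _.
have Ale : A <= 1 + s - s ^+ n.+1 by move: lo hp; rewrite /A /d; lra.
have s1 : s ^+ n.+1 <= 1.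
  by rewrite exprn_ile1 // (le_trans hi) // gerBl divr_ge0.
have B0 : 0 <= 1 + s - s ^+ n.+1 by move: s0 s1; lra.
(* The centroid cost is at least [(1 + s - s^(n+1)) b], as [b >= 1], and the optimum is at most
   [(1 + h) b]. *)
apply: (@le_trans _ _ ((1 + s - s ^+ n.+1) * OPT (ie X) (iw X))); first by rewrite ler_pM2r.
apply: (@le_trans _ _ ((1 + s - s ^+ n.+1) * ((1 + h) * b))).
  by rewrite ler_wpM2l // (le_trans Of).
rewrite mulrCA [leRHS]mulrC ler_wpM2l ?addr_ge0 // ?(ltW h0) //.
by have := ler_wpM2l sp b1; lra.
Qed.

Lemma unbounded_instance (R : realType) (D n : nat) : (3 <= D)%N ->
  exists X : inst R, [/\ is_tree (ie X), max_deg_le (ie X) D, forall a, 0 <= iw X a,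
    \sum_a iw X a = 1 & n%:R / 4 <= OPT (ie X) (iw X) /\
    forall C, centroid_tree (ie X) (iw X) C ->
    (2 - 4 / 2 ^+ D) * OPT (ie X) (iw X) - 1 <= cost (iw X) C].
Proof.
move=> D3; have pE : 4 / 2 ^+ D = 1 / 2 ^+ D.-2 :> R.
  by case: D D3 => [|[|k]] // _; rewrite !exprS /=; field; rewrite expf_neq0.
have DE : D.-1 = (D.-2).+1 by case: D D3 {pE} => [|[|]].
set p : R := 4 / 2 ^+ D in pE *.
have p0 : 0 < p by rewrite divr_gt0 // exprn_gt0.
have p1 : p <= 1.
  by rewrite pE ler_pdivrMr ?exprn_gt0 // mul1r exprn_ege1 // ler1n.
(* With [d = p / N] and a loss of [e = d (8 n + 10)] per step, [(n + 1) e = p]. So [n] steps lose at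
   most [p], and [1 - t - p = -1] for [t = 2 - p]. *)
pose N : R := n.+1%:R * (8 * n + 10)%:R.
have n1 : 1 <= n.+1%:R :> R by rewrite ler1n.
have n10 : (8 * n + 10)%:R = 8 * n.+1%:R + 2 :> R.
  by rewrite -[n.+1%:R]natr1 natrD natrM; ring.
pose d := p / N; pose q := (1 - d) / 2.
have N10 : 10 <= N by rewrite /N n10; nra.
have N0 : 0 < N by apply: lt_le_trans N10; rewrite ltr0n.
have d0 : 0 < d by rewrite divr_gt0.
have dN : d * N = p by rewrite /d divfK // gt_eqF.
have d1 : d <= 1 / 10 by nra.
have q0 : 0 < q by rewrite /q; move: d1; lra.
have qd : 2 * q + d = 1 by rewrite /q; lra.
have n0 : 0 <= n%:R :> R by [].
have nS : n.+1%:R = n%:R + 1 :> R by rewrite natr1.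
have dn : d * (n%:R + 1) * (8 * (n%:R + 1) + 2) = p by rewrite -dN /N n10 nS; ring.
(* In [e], the part [2 d] covers the error of the geometric sum, and [d (8 n + 8)] covers the depth
   of the connecting vertices, using [t <= 2]. *)
pose t := 2 - p; pose e := d * (8 * n%:R + 10).
have e0 : 0 <= e by rewrite mulr_ge0 ?(ltW d0) // addr_ge0 // mulr_ge0.
have t12 : 1 <= t <= 2 by rewrite /t; apply/andP; split; move: p0 p1; lra.
have dn0 := mulr_ge0 (ltW d0) n0; have dnn0 := mulr_ge0 dn0 n0.
have h2 : 2 * d * n%:R <= 1 by move: d0 dn dn0 dnn0 p1; lra.
have he : t - geom q D.-1 + 2 * t * d * (2 * n + 2)%:R <= e.
  rewrite DE (geomS q0 d0 qd); have /andP[+ _] := geom_half_bounds q0 d0 qd D.-2.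
  rewrite -pE natrD natrM => lo; rewrite /e.
  have : t * (d * (2 * n%:R + 2)) <= 2 * (d * (2 * n%:R + 2)).
    case/andP: t12 => _ t2; apply: ler_wpM2r => //.
    by rewrite mulr_ge0 ?(ltW d0) // addr_ge0 // mulr_ge0.
  by move: lo; rewrite /t; lra.
have [X [a [l [c [b [f [gX uX mX hb hc]]]]]]] :=
  unbounded_family q0 d0 qd D3 t12 h2 e0 he (leqnn n).
have [tX w0 X1 _ _] := gX; have /andP[bO Of] := good_OPT gX uX.
exists X; split=> //; first by move=> z; apply: (marked_deg mX).
split=> [|C cC]; first exact: le_trans bO.
rewrite (good_centroid_cost gX cC) -/p -/t.
have ne : n%:R * e <= p.
  by rewrite -dn /e; move: dn0 dnn0 d0; lra.
have : t * OPT (ie X) (iw X) <= t * f.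
  by case/andP: t12 => t1 _; rewrite ler_wpM2l // (le_trans ler01).
by move: hc; rewrite /t; move: ne; lra.
Qed.

(** * The limit in (i), and both sequences assembled *)

Local Open Scope classical_set_scope.
Local Open Scope ring_scope.

Lemma bounded_limit (R : realType) (D : nat) :
  let h n : R := n.+1%:R^-1 in
  (2 - 1 / 2 ^+ D - h n ^+ 2 / 2 - (1 - 1 / 2 ^+ D) ^+ n.+1) / (1 + h n)
    @[n --> \oo] --> (2 - 1 / 2 ^+ D : R).
Proof.
move=> h; have h0 : h n @[n --> \oo] --> (0 : R) by exact: cvg_harmonic.
have s0 : (1 - 1 / 2 ^+ D) ^+ n.+1 @[n --> \oo] --> (0 : R).
  have : `|1 - 1 / 2 ^+ D| < 1 :> R.
    have p0 : 0 < 1 / 2 ^+ D :> R by rewrite divr_gt0 // exprn_gt0.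
    have p1 : 1 / 2 ^+ D <= 1 :> R by rewrite ler_pdivrMr ?exprn_gt0 // mul1r exprn_ege1 // ler1n.
    by rewrite ger0_norm; move: p0 p1; lra.
  move/cvg_expr => s0; by rewrite (cvg_shiftS (fun n => (1 - 1 / 2 ^+ D) ^+ n : R)).
have L : (2 - 1 / 2 ^+ D - h n ^+ 2 / 2 - (1 - 1 / 2 ^+ D) ^+ n.+1) / (1 + h n)
    @[n --> \oo] --> ((2 - 1 / 2 ^+ D - 0 * 0 / 2 - 0) / (1 + 0) : R).
  apply: cvgM; last by apply: cvgV; [rewrite addr0 oner_eq0|apply: cvgD; [exact: cvg_cst|]].
  apply: cvgB => //; apply: cvgB; first exact: cvg_cst.
  by apply: cvgM; [apply: cvgM|exact: cvg_cst].
by rewrite !mul0r !subr0 addr0 divr1 in L.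
Qed.

Unset Implicit Arguments.

Theorem theorem5 (R : realType) (D : nat) (hD : (3 <= D)%N) :
  (exists (T : nat -> finType) (e : forall n, rel (T n)) (w : forall n, T n -> R),
     (forall n, is_tree (e n)) /\ (forall n, max_deg_le (e n) D) /\
     (forall n x, 0 <= w n x) /\
     forall C : forall n, rtree (T n),
       (forall n, centroid_tree (e n) (w n) (C n)) ->
       (cost (w n) (C n) / OPT (e n) (w n)) @[n --> \oo] --> (2 - 1 / 2 ^+ D : R))
  /\
  (exists (T : nat -> finType) (e : forall n, rel (T n)) (w : forall n, T n -> R),
     (forall n, is_tree (e n)) /\ (forall n, max_deg_le (e n) D) /\
     (forall n x, 0 <= w n x) /\
     (forall n, wsum (w n) (finset.setTfor (T n)) = 1) /\
     (OPT (e n) (w n) @[n --> \oo] --> +oo) /\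
     forall n (C : rtree (T n)), centroid_tree (e n) (w n) C ->
       cost (w n) C >= (2 - 4 / 2 ^+ D) * OPT (e n) (w n) - 1).
Proof.
split.
  have /choice[X HX] := fun n => bounded_instance R n hD.
  exists (fun n => iV (X n)), (fun n => ie (X n)), (fun n => iw (X n)).
  split; first by move=> n; have [] := HX n.
  split; first by move=> n; have [] := HX n.
  split; first by move=> n; have [] := HX n.
  move=> C HC; have L := @bounded_limit R D; simpl in L.
  apply: (squeeze_cvgr (h := fun=> 2 - 1 / 2 ^+ D) _ L); last exact: cvg_cst.
  by apply: nearW => n; have [_ _ _] := HX n; apply.
have /choice[X HX] := fun n => unbounded_instance R n hD.
exists (fun n => iV (X n)), (fun n => ie (X n)), (fun n => iw (X n)).
split; first by move=> n; have [] := HX n.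
split; first by move=> n; have [] := HX n.
split; first by move=> n; have [] := HX n.
split.
  move=> n; have [_ _ _ + _] := HX n; rewrite /wsum => <-.
  by apply: eq_bigl => a; rewrite inE.
split; last by move=> n; have [_ _ _ _ []] := HX n.
apply/cvgryPge => A; near=> n.
have [_ _ _ _ [+ _]] := HX n; apply: le_trans.
by rewrite ler_pdivlMr //; near: n; exact: nbhs_infty_ger.
Unshelve. all: by end_near.
Qed.
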